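(* Let $G$ be a Hausdorff, ample groupoid, and let $R$ be a commutative ring with identity. Let $Z(A_R(G))$ denote the center of $A_R(G)$. (1) Suppose $G$ is effective and minimal, and $G^{(0)}$ is compact. Then $Z(A_R(G)) = R\,1_{G^{(0)}} = \{ r 1_{G^{(0)}} : r \in R\}$. (2) Suppose $G$ is minimal and $G^{(0)}$ is not compact. Then $Z(A_R(G)) = \{0\}$.
   Context: Groupoids: for a groupoid $G$, $r(\alpha)=\alpha\alpha^{-1}$ and $s(\alpha)=\alpha^{-1}\alpha$ are the range and source maps, their common image is the unit space $G^{(0)} \subseteq G$, and $\alpha\beta$ is defined iff $s(\alpha)=r(\beta)$. A topological groupoid is a groupoid with a topology making composition and inversion continuous. An open bisection is an open set $B \subseteq G$ such that $r|_B$ and $s|_B$ are homeomorphisms onto open subsets of $G^{(0)}$. $G$ is ample if it has a basis of compact open bisections. Let $\operatorname{Iso}(G)=\{\gamma\in G : s(\gamma)=r(\gamma)\}$; $G$ is effective if the interior of $\operatorname{Iso}(G)\setminus G^{(0)}$ is empty. A subset $U\subseteq G^{(0)}$ is invariant if $r(s^{-1}(U))=U$; $G$ is minimal if $G^{(0)}$ has no open invariant subsets other than $\emptyset$ and $G^{(0)}$ (equivalently, each orbit $[u]=r(s^{-1}(u))$, $u\in G^{(0)}$, is dense in $G^{(0)}$). Steinberg algebra: for $G$ Hausdorff and ample, $A_R(G)$ is the $R$-algebra of all locally constant functions $f: G\to R$ with compact support, with pointwise addition and scalar multiplication and product the convolution $(f*g)(\alpha)=\sum_{r(\beta)=r(\alpha)}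 f(\beta)g(\beta^{-1}\alpha)$ (a sum with finitely many nonzero terms). For a compact open set $K\subseteq G$, $1_K \in A_R(G)$ denotes its characteristic function; $G^{(0)}$ is open in $G$. *)

(* Defs.v *)
From HB Require Import structures.
From mathcomp Require Import all_boot all_order all_algebra.
From mathcomp Require Import all_classical all_reals all_analysis.

Set Implicit Arguments.
Unset Strict Implicit.
Unset Printing Implicit Defensive.

Import GRing.Theory.
Local Open Scope classical_set_scope.
Local Open Scope ring_scope.

(* The partial product is represented by a total function whose values are
   meaningful only on composable pairs, i.e. when src a = rng b, where
   rng a = a a^-1 and src a = a^-1 a; every law is guarded by composability.
   The composability of (a^-1, a) and (a, a^-1) follows from ginvK. *)
HB.mixin Record isGroupoid G := {
  gmul : G -> G -> G;
  ginv : G -> G;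
  ginvK : forall a, ginv (ginv a) = a;
  rng_gmul : forall a b,
    gmul (ginv a) a = gmul b (ginv b) ->
    gmul (gmul a b) (ginv (gmul a b)) = gmul a (ginv a);
  src_gmul : forall a b,
    gmul (ginv a) a = gmul b (ginv b) ->
    gmul (ginv (gmul a b)) (gmul a b) = gmul (ginv b) b;
  gmulA : forall a b c,
    gmul (ginv a) a = gmul b (ginv b) -> gmul (ginv b) b = gmul c (ginv c) ->
    gmul a (gmul b c) = gmul (gmul a b) c;
  gmulKV : forall a b,
    gmul (ginv a) a = gmul b (ginv b) -> gmul (ginv a) (gmul a b) = b;
  gmulVK : forall a b,
    gmul (ginv a) a = gmul b (ginv b) -> gmul (gmul a b) (ginv b) = a
}.

#[short(type="groupoidType")]
HB.structure Definition Groupoid := {G of isGroupoid G}.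

Definition rng {G : groupoidType} (a : G) : G := gmul a (ginv a).
Definition src {G : groupoidType} (a : G) : G := gmul (ginv a) a.

Definition composable {G : groupoidType} : set (G * G) :=
  [set p | src p.1 = rng p.2].

(* The unit space G^(0); the images of rng and src coincide. *)
Definition units (G : groupoidType) : set G := range (@rng G).
Arguments units : clear implicits.

Definition isotropy (G : groupoidType) : set G := [set a | src a = rng a].
Arguments isotropy : clear implicits.

#[short(type="preTopologicalGroupoidType")]
HB.structure Definition PreTopologicalGroupoid :=
  {G of Topological G & Groupoid G}.

HB.mixin Record PreTopologicalGroupoid_isTopologicalGroupoid G
    of PreTopologicalGroupoid G := {
  gmul_continuous :
    {within @composable G, continuous (fun p : G * G => gmul p.1 p.2)};
  ginv_continuous : continuous (@ginv G)
}.

#[short(type="topologicalGroupoidType")]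
HB.structure Definition TopologicalGroupoid :=
  {G of PreTopologicalGroupoid G
      & PreTopologicalGroupoid_isTopologicalGroupoid G}.

(* U is a subset of A that is open for the subspace topology of A. *)
Definition open_in {T : topologicalType} (A U : set T) : Prop :=
  exists2 V : set T, open V & U = V `&` A.

(* f restricts to a homeomorphism from A onto B = f(A), with inverse g. *)
Definition homeomorphism_on {T : topologicalType} (A B : set T) (f : T -> T)
    : Prop :=
  [/\ {within A, continuous f}, f @` A = B
    & exists2 g : T -> T, forall x, A x -> g (f x) = x
                        & {within B, continuous g}].

Definition open_bisection {G : topologicalGroupoidType} (B : set G) : Prop :=
  [/\ open B,
      exists2 U, open_in (units G) U & homeomorphism_on B U (@rng G)
    & exists2 U, open_in (units G) U & homeomorphism_on B U (@src G)].

Definition ample (G : topologicalGroupoidType) : Prop :=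
  exists2 Bs : set (set G),
    basis Bs & forall B, Bs B -> compact B /\ open_bisection B.

Definition effective (G : topologicalGroupoidType) : Prop :=
  interior (isotropy G `\` units G) = set0.

Definition invariant_set {G : groupoidType} (U : set G) : Prop :=
  @rng G @` (@src G @^-1` U) = U.

Definition minimal (G : topologicalGroupoidType) : Prop :=
  forall U : set G, open_in (units G) U -> invariant_set U ->
    U = set0 \/ U = units G.

Definition locally_constant {T : topologicalType} {S : Type} (f : T -> S)
    : Prop :=
  forall x, \forall y \near x, f y = f x.

Definition compactly_supported {T : topologicalType} {R : pzRingType}
    (f : T -> R) : Prop :=
  compact (closure [set x | f x <> 0]).

(* The underlying set of A_R(G), inside the R-module of functions G -> R with
   its pointwise operations. *)
Definition steinberg (R : comPzRingType) (G : topologicalGroupoidType)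
    : set (G -> R) :=
  [set f | locally_constant f /\ compactly_supported f].
Arguments steinberg : clear implicits.

(* Finitely supported sum; its support is finite when f is in A_R(G) and G is
   Hausdorff and ample. *)
Definition convolution {R : comPzRingType} {G : topologicalGroupoidType}
    (f g : G -> R) : G -> R :=
  fun a => \sum_(b \in [set b | rng b = rng a]) f b * g (gmul (ginv b) a).

Definition steinberg_center (R : comPzRingType) (G : topologicalGroupoidType)
    : set (G -> R) :=
  [set f | steinberg R G f
    /\ forall g, steinberg R G g -> convolution f g = convolution g f].
Arguments steinberg_center : clear implicits.

(* Main.v *)
Require Import Defs.
From mathcomp Require Import all_boot all_order all_algebra.
From mathcomp Require Import all_classical all_reals all_analysis.
Import GRing.Theory.
Local Open Scope classical_set_scope.
Local Open Scope ring_scope.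

(** Test a central function [f] against indicators of compact open bisections.
    Commuting with [1_U], for [U] a small compact open set of units, forces [f]
    to vanish off the isotropy; commuting with [1_B], for a bisection [B]
    containing [g], gives [f (g a g^-1) = f a] for isotropic [a].  Hence
    [r(supp f)] is a compact open invariant set of units, and minimality makes
    it empty when the unit space is not compact.  If [G] is effective, [f] is
    supported on the units, where its level sets are open and invariant, so
    minimality makes it constant there. *)

(** * Groupoid algebra: units, cancellation, division *)

Section groupoid_theory.
Context {G : groupoidType}.
Implicit Types a b c x : G.

Lemma rngV a : rng (ginv a) = src a.
Proof. by rewrite /rng /src ginvK. Qed.

Lemma srcV a : src (ginv a) = rng a.
Proof. by rewrite /rng /src ginvK. Qed.

Lemma rngM a b : src a = rng b -> rng (gmul a b) = rng a.
Proof. exact: rng_gmul. Qed.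

Lemma srcM a b : src a = rng b -> src (gmul a b) = src b.
Proof. exact: src_gmul. Qed.

Lemma rng_rng a : rng (rng a) = rng a.
Proof. by apply: rngM; rewrite rngV. Qed.

Lemma src_rng a : src (rng a) = rng a.
Proof. by rewrite {1}/rng srcM ?srcV ?rngV. Qed.

Lemma rng_src a : rng (src a) = src a.
Proof. by rewrite -(rngV a) rng_rng. Qed.

Lemma src_src a : src (src a) = src a.
Proof. by rewrite -(rngV a) src_rng. Qed.

Lemma units_rng a : units G (rng a).
Proof. by exists a. Qed.

Lemma units_src a : units G (src a).
Proof. by rewrite -rngV; exact: units_rng. Qed.

Lemma rng_unit a : units G a -> rng a = a.
Proof. by move=> [b _ <-]; exact: rng_rng. Qed.

Lemma src_unit a : units G a -> src a = a.
Proof. by move=> [b _ <-]; exact: src_rng. Qed.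

Lemma gmul_rng a : gmul (rng a) a = a.
(* Right cancellation for the pair [a], [ginv a], once the last factor [a] is read as the inverse of
   [ginv a]. *)
Proof. by rewrite -{2}[a]ginvK; apply: gmulVK; rewrite ginvK. Qed.

Lemma gmul_src a : gmul a (src a) = a.
Proof. by rewrite -{1}[a]ginvK; apply: gmulKV; rewrite ginvK. Qed.

Lemma ginv_unit a : units G a -> ginv a = a.
Proof.
move=> ua; have := gmul_rng (ginv a).
by rewrite rngV => <-; rewrite src_unit// -[RHS]rng_unit.
Qed.

Lemma gmul_ginvKl b x : rng b = rng x -> gmul b (gmul (ginv b) x) = x.
Proof.
by move=> bx; rewrite -{1}[b]ginvK; apply: gmulKV; rewrite ginvK.
Qed.

Lemma gmul_ginvKr x c : src x = src c -> gmul (gmul x (ginv c)) c = x.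
Proof.
by move=> xc; rewrite -{2}[c]ginvK; apply: gmulVK; rewrite ginvK.
Qed.

(** Locates the only index [b] that can contribute to a convolution at [x] when the right factor is
    tested at [c]. *)
Lemma gmul_ginv_eq b x c : rng b = rng x -> gmul (ginv b) x = c ->
  b = gmul x (ginv c).
Proof.
move=> bx <-; rewrite -{1}(gmul_ginvKl _ _ bx); symmetry; apply: gmulVK.
by rewrite -[RHS]/(rng _) rngM ?srcV// rngV.
Qed.

Lemma gmul_ginvK x c : src x = src c ->
  gmul (ginv (gmul x (ginv c))) x = c.
Proof.
move=> xc; rewrite -{2}(gmul_ginvKr _ _ xc); apply: gmulKV.
by rewrite -[LHS]/(src _) srcM ?rngV// srcV.
Qed.

End groupoid_theory.

(** * Convolution with functions supported on bisections *)

Section convolution_theory.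
Context {G : topologicalGroupoidType} {R : comPzRingType}.
Implicit Types (B : set G) (f h : G -> R) (c x : G).

Lemma fsbig_single {I : choiceType} (P : set I) (i : I) (F : I -> R) :
  P i -> (forall j, P j -> j <> i -> F j = 0) ->
  \sum_(j \in P) F j = F i.
Proof.
move=> Pi F0; rewrite -[RHS](fsbig_set1 +%R i F); symmetry.
apply: fsbig_widen; first by move=> _ ->.
by move=> j [Pj ji]; apply: F0.
Qed.

(** Indices [b] range over the fibre of [rng x], and injectivity of [rng] on [B] leaves only [c]
    there. *)
Lemma convolution_bisectionl B f h c x :
  (forall y, ~ B y -> h y = 0) ->
  (forall y, B y -> rng y = rng c -> y = c) -> rng c = rng x ->
  convolution h f x = h c * f (gmul (ginv c) x).
Proof.
move=> h0 Binj cx; apply: fsbig_single => // b bx bc; rewrite h0 ?mul0r//.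
by move=> Bb; apply: bc; apply: Binj => //; rewrite bx.
Qed.

(** Every argument [gmul (ginv b) x] of [h] has source [src x], so one lying in [B] must be [c];
    this determines [b]. *)
Lemma convolution_bisectionr B f h c x :
  (forall y, ~ B y -> h y = 0) ->
  (forall y, B y -> src y = src c -> y = c) -> src x = src c ->
  convolution f h x = f (gmul x (ginv c)) * h c.
Proof.
move=> h0 Binj xc; rewrite /convolution.
rewrite (fsbig_single _ (gmul x (ginv c))) ?gmul_ginvK//.
  by rewrite /= rngM// rngV.
move=> b bx bc; rewrite h0 ?mulr0// => Bb; apply: bc.
by apply: gmul_ginv_eq => //; apply: Binj => //; rewrite srcM ?srcV.
Qed.

Lemma convolution_src_disjoint B f h x :
  (forall y, ~ B y -> h y = 0) -> (forall y, B y -> src y <> src x) ->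
  convolution f h x = 0.
Proof.
move=> h0 Bx; apply: fsbig1 => b bx; rewrite h0 ?mulr0// => /Bx; apply.
by rewrite srcM ?srcV.
Qed.

Lemma indic_notin B y : ~ B y -> \1_B y = 0 :> R.
Proof. by move=> By; rewrite indicE memNset. Qed.

Lemma indic_in B y : B y -> \1_B y = 1 :> R.
Proof. by move=> By; rewrite indicE mem_set. Qed.

Lemma open_level_set (f : G -> R) (r : R) :
  locally_constant f -> open [set x | f x = r].
Proof.
by move=> lf; rewrite openE => x /= <-; apply: filterS (lf x).
Qed.

Lemma open_support f : locally_constant f -> open [set x | f x <> 0].
Proof.
by move=> lf; rewrite openE => x /= fx0; apply: filterS (lf x) => y /= ->.
Qed.

Lemma closed_support f : locally_constant f -> closed [set x | f x <> 0].
Proof.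
by move=> lf; apply: open_closedC; exact: open_level_set.
Qed.

(** In a Hausdorff space a compact open set is clopen, which gives local constancy on both sides of
    its boundary. *)
Lemma steinberg_scaled_indic (r : R) B :
  hausdorff_space G -> open B -> compact B ->
  steinberg R G (fun x => r * \1_B x).
Proof.
move=> hG oB cB; have clB : closed B := compact_closed hG cB.
split.
  move=> x; have [Bx|nBx] := pselect (B x).
    apply: filterS (open_nbhs_nbhs (conj oB Bx)) => y By.
    by rewrite !indic_in.
  apply: filterS (open_nbhs_nbhs (conj (closed_openC clB) nBx)) => y nBy.
  by rewrite !indic_notin.
apply: subclosed_compact cB _; first exact: closed_closure.
rewrite [X in _ `<=` X](iffLR (closure_id B))//; apply: closureS => x /=.
by move=> x0; apply: contrapT => nBx; apply: x0; rewrite indic_notin ?mulr0.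
Qed.

Lemma steinberg_indic B : hausdorff_space G -> open B -> compact B ->
  steinberg R G (\1_B).
Proof.
move=> hG oB cB; rewrite (_ : \1_B = fun x => 1 * \1_B x).
  exact: steinberg_scaled_indic.
by apply/funext => x; rewrite mul1r.
Qed.

End convolution_theory.

(** * Topology of ample groupoids *)

Section ample_groupoid.
Context {G : topologicalGroupoidType}.
Hypothesis ampleG : ample G.

Lemma compact_bisection_nbhs {A : set G} {a : G} : open A -> A a ->
  exists B, [/\ B a, B `<=` A, compact B & open_bisection B].
Proof.
move=> oA Aa; case: ampleG => Bs [_ Bbasis] BsP.
have [B [BsB Ba] BA] := Bbasis a _ (open_nbhs_nbhs (conj oA Aa)).
by exists B; have [] := BsP _ BsB.
Qed.

Lemma bisection_rng_inj {B : set G} : open_bisection B ->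
  forall y c, B y -> B c -> rng y = rng c -> y = c.
Proof.
move=> [_ [U _ [_ _ [g gK _]]] _] y c By Bc yc.
by rewrite -(gK _ By) yc gK.
Qed.

Lemma bisection_src_inj {B : set G} : open_bisection B ->
  forall y c, B y -> B c -> src y = src c -> y = c.
Proof.
move=> [_ _ [U _ [_ _ [g gK _]]]] y c By Bc yc.
by rewrite -(gK _ By) yc gK.
Qed.

Lemma rng_continuous : continuous (@rng G).
Proof.
move=> a; have [B [Ba _ _ [oB [U _ [cB _ _]] _]]] :=
  compact_bisection_nbhs openT (I : [set: G] a).
by move: cB; rewrite continuous_open_subspace// => /(_ a); apply; rewrite inE.
Qed.

Lemma open_units : open (units G).
Proof.
rewrite openE => u uu.
have [B [Bu _ _ bB]] := compact_bisection_nbhs openT (I : [set: G] u).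
have [oB _ _] := bB.
have nB := open_nbhs_nbhs (conj oB Bu).
have nrB : nbhs u (@rng G @^-1` B).
  by apply: rng_continuous; rewrite rng_unit.
apply: filterS (filterI nB nrB) => x [Bx Brx].
(* Near a unit, [x] and [rng x] lie in one bisection and have the same range, so they coincide. *)
rewrite (bisection_rng_inj bB _ _ Bx Brx) ?rng_rng//.
exact: units_rng.
Qed.

Lemma closed_units : hausdorff_space G -> closed (units G).
Proof.
move=> hG a cla; suff -> : a = rng a by exact: units_rng.
(* The units are the fixed points of the continuous map [rng]: a unit [u] near [a] lies in [B], and
   in [A] as [rng u], so [a] and [rng a] cannot be separated. *)
symmetry; apply: hG => A B nA nB.
have nrA : nbhs a (@rng G @^-1` A) by exact: rng_continuous.
have [u [uu [Bu Aru]]] := cla _ (filterI nB nrA).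
by exists u; split=> //; rewrite -(rng_unit _ uu).
Qed.

Lemma open_rng_image {W : set G} : open W -> open (@rng G @` W).
Proof.
move=> oW; rewrite openE => _ [a Wa <-].
have [B [Ba BW _ [_ [U [V oV UV] [_ BU _]] _]]] :=
  compact_bisection_nbhs oW Wa.
have oU : open U by rewrite UV; apply: openI => //; exact: open_units.
have Ura : U (rng a) by rewrite -BU; exists a.
apply: filterS (open_nbhs_nbhs (conj oU Ura)).
by rewrite -BU; apply: image_subset.
Qed.

End ample_groupoid.

(** * Properties of a central function *)

Section center.
Context {G : topologicalGroupoidType} {R : comPzRingType}.
Hypotheses (hausdorffG : hausdorff_space G) (ampleG : ample G).
Context {f : G -> R}.
Hypothesis fZ : steinberg_center R G f.

Let lcf : locally_constant f. Proof. by case: fZ => -[]. Qed.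

Let f_indicC B : open B -> compact B ->
  convolution (\1_B) f = convolution f (\1_B).
Proof.
move=> oB cB; case: fZ => _ fC; symmetry; apply: fC.
exact: steinberg_indic.
Qed.

Lemma center_isotropy a : f a <> 0 -> src a = rng a.
Proof.
move=> fa0; apply: contrapT => sr; apply: fa0.
(* A set of units [B] around [rng a] that avoids [src a] separates the two products at [a]: [\1_B]
   on the left gives [f a], on the right it gives 0. *)
have oA : open (units G `\` [set src a]).
  apply: openI; first exact: open_units.
  by apply: closed_openC; exact/accessible_closed_set1/hausdorff_accessible.
have Ara : (units G `\` [set src a]) (rng a).
  by split; [exact: units_rng | move=> /= rs; apply: sr].
have [B [Ba BA cB [oB _ _]]] := compact_bisection_nbhs ampleG oA Ara.
have := congr1 (fun h => h a) (f_indicC _ oB cB) => /=.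
rewrite (convolution_bisectionl B _ _ (rng a)) ?rng_rng//; last first.
- by move=> y /BA[uy _]; rewrite rng_unit.
- exact: indic_notin.
rewrite ginv_unit ?gmul_rng; last exact: units_rng.
rewrite indic_in// mul1r (convolution_src_disjoint B)//.
  exact: indic_notin.
by move=> y /BA[uy ya]; rewrite src_unit.
Qed.

Lemma center_conj c a : src c = rng a -> src a = rng a ->
  f (gmul (gmul c a) (ginv c)) = f a.
Proof.
move=> ca aa.
have [B [Bc _ cB bB]] := compact_bisection_nbhs ampleG openT (I : [set: G] c).
have [oB _ _] := bB.
(* At [gmul c a], the left product strips [c] and gives [f a]; since [a] is isotropic, this point
   also has source [src c], so the right product gives the conjugate. *)
have := congr1 (fun h => h (gmul c a)) (f_indicC _ oB cB) => /=.
rewrite (convolution_bisectionl B _ _ c) ?rngM//; last first.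
- by move=> y By; exact: bisection_rng_inj bB _ _ By Bc.
- exact: indic_notin.
rewrite (convolution_bisectionr B _ _ c) ?srcM//; last first.
- by rewrite ca.
- by move=> y By; exact: bisection_src_inj bB _ _ By Bc.
- exact: indic_notin.
by rewrite indic_in// mul1r mulr1 gmulKV.
Qed.

(** Conjugating the unit [src c] by [c] yields [rng c]. *)
Lemma center_orbit c : f (rng c) = f (src c).
Proof.
rewrite -(center_conj c (src c)) ?rng_src ?src_src//.
by rewrite gmul_src.
Qed.

(** Support elements are isotropic, so an arrow [c] starting at [rng a] carries [a] to a conjugate
    that is again in the support and has range [rng c]. *)
Lemma invariant_rng_support : invariant_set (@rng G @` [set x | f x <> 0]).
Proof.
apply/seteqP; split=> [_ [c [a fa0 ac] <-]|_ [a fa0 <-]]; last first.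
  exists (rng a); last exact: rng_rng.
  by exists a => //; rewrite src_rng.
have ra := center_isotropy _ fa0.
exists (gmul (gmul c a) (ginv c)); first by rewrite /= center_conj.
by rewrite !rngM// ?srcM// ?rngV ra.
Qed.

Lemma center_eq0 : minimal G -> ~ compact (units G) -> f = fun=> 0.
Proof.
move=> minG ncG; set U := @rng G @` [set x | f x <> 0].
have oU : open_in (units G) U.
  exists U; first by apply: open_rng_image => //; exact: open_support.
  by apply/esym/setIidPl => _ [a _ <-]; exact: units_rng.
have [U0|UG] := minG U oU invariant_rng_support.
  apply/funext => x; apply: contrapT => fx0.
  have : U (rng x) by exists x.
  by rewrite U0.
(* Otherwise the unit space would be the continuous image of the support, which is closed and hence
   itself compact. *)
case: ncG; rewrite -UG; apply: continuous_compact.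
  by apply: continuous_subspaceT; exact: rng_continuous.
rewrite (iffLR (closure_id _) (closed_support _ lcf)).
by case: fZ => -[].
Qed.

Lemma center_effective_support : effective G ->
  forall x, ~ units G x -> f x = 0.
Proof.
move=> effG x ux; apply: contrapT => fx0.
suff : interior (isotropy G `\` units G) x by rewrite effG.
(* The support off the units is open because the units are closed, and it consists of isotropy, so
   effectiveness leaves no room for it. *)
have oS : open ([set x | f x <> 0] `\` units G).
  apply: openI; first exact: open_support.
  by apply: closed_openC; exact: closed_units.
apply: filterS (open_nbhs_nbhs (conj oS (conj fx0 ux))) => y [fy0 uy].
by split=> //; exact: center_isotropy.
Qed.

Lemma center_unit_const : minimal G ->
  forall u v, units G u -> units G v -> f u = f v.
Proof.
move=> minG u v uu uv; set U := [set x | f x = f v] `&` units G.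
have Uv : U v by [].
have oU : open_in (units G) U.
  by exists [set x | f x = f v] => //; exact: open_level_set.
have iU : invariant_set U.
  apply/seteqP; split=> [_ [c [fc _] <-]|x [fx ux]].
    by split; [rewrite /= center_orbit | exact: units_rng].
  by exists x; [rewrite /= src_unit | exact: rng_unit].
have [U0|UG] := minG U oU iU; first by move: Uv; rewrite U0.
by move: uu; rewrite -UG => -[].
Qed.

End center.

Lemma unit_multiple_center {G : topologicalGroupoidType} {R : comPzRingType}
    (r : R) : hausdorff_space G -> ample G -> compact (units G) ->
  steinberg_center R G (fun x => r * \1_(units G) x).
Proof.
move=> hG aG cG; have oG := open_units aG.
split=> [|g _]; first exact: steinberg_scaled_indic.
have h0 (y : G) : ~ units G y -> r * \1_(units G) y = 0.
  by move=> uy; rewrite indic_notin ?mulr0.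
apply/funext => a.
have ura := units_rng a; have usa := units_src a.
rewrite (convolution_bisectionl (units G) _ _ (rng a)) ?rng_rng//; last first.
  by move=> y uy; rewrite rng_unit.
rewrite (convolution_bisectionr (units G) _ _ (src a)) ?src_src//; last first.
  by move=> y uy; rewrite src_unit.
(* Only [rng a] contributes on one side and only [src a] on the other; both products reduce to
   [r * g a]. *)
by rewrite !ginv_unit// gmul_rng gmul_src !indic_in// mulr1 mulrC.
Qed.

Lemma zero_center (G : topologicalGroupoidType) (R : comPzRingType) :
  steinberg_center R G (fun=> 0).
Proof.
split=> [|g _].
  split=> [x|]; first exact: nearW.
  rewrite /compactly_supported (_ : [set x | _] = set0).
    by rewrite closure0; exact: compact0.
  by apply/seteqP; split.
apply/funext => a; rewrite /convolution !fsbig1// => b _.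
  by rewrite mulr0.
by rewrite mul0r.
Qed.

Theorem theorem5p2 (G : topologicalGroupoidType) (R : comPzRingType)
    (hausdorffG : hausdorff_space G) (ampleG : ample G) :
  (effective G -> minimal G -> compact (units G) ->
     steinberg_center R G
     = [set f | exists r : R, f = (fun x => r * \1_(units G) x)])
  /\
  (minimal G -> ~ compact (units G) ->
     steinberg_center R G = [set (fun=> 0)]).
Proof.
split=> [effG minG cG|minG ncG]; apply/seteqP; split=> f.
- move=> fZ; have f0 := center_effective_support hausdorffG ampleG fZ effG.
  have [[u uu]|nu] := pselect (exists u, units G u).
    exists (f u); apply/funext => x; have [ux|ux] := pselect (units G x).
      rewrite indic_in// mulr1.
      exact: (center_unit_const hausdorffG ampleG fZ).
    by rewrite indic_notin// mulr0 f0.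
  (* With no units there is no value of [f] to take as scalar, and [f] vanishes everywhere. *)
  exists 0; apply/funext => x; rewrite mul0r f0// => ux.
  by apply: nu; exists x.
- by move=> [r ->]; exact: unit_multiple_center.
- by move=> fZ; exact: (center_eq0 hausdorffG ampleG fZ).
- by move=> ->; exact: zero_center.
Qed.
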